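(* For all nonnegative integers $n$ and $m$ the following identities hold: (i) $\displaystyle\sum_{k=0}^n \frac{C_k}{2^{2k}} = 2-\frac{2n+1}{2^{2n}}\,C_n$; (ii) $\displaystyle\sum_{k=1}^n (-1)^{n-k}\binom{n+1}{k}\frac{2^{2k}}{(k+1)\,C_k} = \frac{2}{2n+1}\Big(\frac{2^{2n}}{C_n}-(-1)^n(n+1)\Big)$; (iii) $\displaystyle\sum_{k=0}^\infty \frac{C_k}{2^{2k}\prod_{j=1}^m\bigl(2(k-j)+1\bigr)} = \frac{(-1)^m2^{m+2}}{(m+2)!\,C_{m+1}}$; (iv) $\displaystyle\sum_{k=0}^\infty \frac{C_k}{2^{2k}} = 2$.
   Context: $C_n=\frac{1}{n+1}\binom{2n}{n}$, $n\ge 0$, are the Catalan numbers. Empty sums equal $0$ and empty products equal $1$. *)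

(* Defs.v *)
From mathcomp Require Import all_boot all_order all_algebra.

Set Implicit Arguments.
Unset Strict Implicit.
Unset Printing Implicit Defensive.

Import GRing.Theory.
Local Open Scope ring_scope.

(* Taking values in a field avoids the truncated division of nat. *)
Definition catalan (F : fieldType) (n : nat) : F :=
  n.+1%:R^-1 * 'C(2 * n, n)%:R.
Arguments catalan F n : clear implicits.

(* Main.v *)
(* With w_k = 'C(2k, k) / 4^k one has w_(k+1) = w_k (2k + 1) / (2k + 2).  Then
   C_k / 4^k = w_k / (k + 1), so (i) is an induction; 4^k / ((k + 1) C_k) = 1 / w_k,
   so (ii) is a Chu-Vandermonde sum from which the terms k = 0 and k = n + 1 are
   split off.  The series in (iii) telescopes up to a remainder bounded by w_n,
   which tends to 0 because w_n^2 <= 1 / (2n + 1); (iv) is (iii) with m = 0. *)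
Require Import Defs.
From mathcomp Require Import all_boot all_order all_algebra.
From mathcomp Require Import all_classical all_reals all_analysis.
From mathcomp Require Import zify ring lra.

Import Order.TTheory GRing.Theory Num.Theory.
Import numFieldNormedType.Exports.
Local Open Scope classical_set_scope.
Local Open Scope ring_scope.

(** * Central binomial coefficients and the ratio w_n *)

(** Absorption is applied twice, to pass from 2n to 2n + 1 and from 2n + 1 to 2n + 2; the symmetry
    of row 2n + 1 joins the two. *)
Lemma bin_centralS (n : nat) :
  (n.+1 * 'C(2 * n.+1, n.+1) = 2 * (2 * n + 1) * 'C(2 * n, n))%N.
Proof.
have h1 := mul_bin_diag (2 * n + 1) n.
have h2 := mul_bin_diag (2 * n.+1) n.
have h3 : 'C(2 * n + 1, n.+1) = 'C(2 * n + 1, n).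
  by rewrite -(@bin_sub (2 * n + 1) n); [congr 'C(_, _); lia | lia].
have e1 : (2 * n + 1).-1 = (2 * n)%N by lia.
have e2 : (2 * n.+1).-1 = (2 * n + 1)%N by lia.
rewrite e1 in h1; rewrite e2 in h2; rewrite h3 in h1.
have e3 : (2 * n.+1 * 'C(2 * n + 1, n) = 2 * (n.+1 * 'C(2 * n + 1, n)))%N by ring.
by rewrite -h2 e3 -h1; ring.
Qed.

Section Sums.
Variable R : realFieldType.

Definition central_ratio (n : nat) : R := 'C(2 * n, n)%:R / 2 ^+ (2 * n).

Lemma natSr_neq0 (n : nat) : n%:R + 1 != 0 :> R.
Proof. by rewrite natr1 pnatr_eq0. Qed.

Lemma odd_natr_neq0 (n : nat) : 2 * n%:R + 1 != 0 :> R.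
Proof. by rewrite -natrM natr1 pnatr_eq0. Qed.

Lemma central_ratio0 : central_ratio 0 = 1.
Proof. by rewrite /central_ratio muln0 bin0 expr0 divr1. Qed.

Lemma central_ratioS (n : nat) :
  central_ratio n.+1 = central_ratio n * ((2 * n%:R + 1) / (2 * (n%:R + 1))).
Proof.
rewrite /central_ratio.
have h := congr1 (fun i => i%:R : R) (bin_centralS n).
rewrite !natrM natrD natrM -natr1 in h.
have -> : 'C(2 * n.+1, n.+1)%:R
  = 2 * (2 * n%:R + 1) * 'C(2 * n, n)%:R / (n%:R + 1) :> R.
  by rewrite -h mulrC mulKf ?natSr_neq0.
rewrite mulnS exprD.
have h2 : 2 ^+ (2 * n) != 0 :> R by rewrite expf_neq0 ?pnatr_eq0.
by field; rewrite h2 natSr_neq0.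
Qed.

Lemma central_ratio_gt0 (n : nat) : 0 < central_ratio n.
Proof. by rewrite divr_gt0 ?exprn_gt0 // ltr0n bin_gt0; lia. Qed.

(** The induction step comes down to (2n + 1)(2n + 3) <= (2n + 2)^2. *)
Lemma central_ratio_sqr_le (n : nat) :
  central_ratio n ^+ 2 <= (2 * n%:R + 1)^-1.
Proof.
elim: n => [|n IH]; first by rewrite central_ratio0 mulr0 add0r invr1 expr1n.
have n0 : 0 <= n%:R :> R by [].
rewrite central_ratioS exprMn.
apply: (@le_trans _ _
  ((2 * n%:R + 1)^-1 * ((2 * n%:R + 1) / (2 * (n%:R + 1))) ^+ 2)).
  by rewrite ler_wpM2r ?sqr_ge0.
have -> : (2 * n%:R + 1)^-1 * ((2 * n%:R + 1) / (2 * (n%:R + 1))) ^+ 2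
    = (2 * n%:R + 1) / (2 * (n%:R + 1)) ^+ 2 :> R.
  by field; rewrite natSr_neq0 odd_natr_neq0.
rewrite -natr1 ler_pdivrMr ?exprn_gt0; try lra.
by rewrite [leRHS]mulrC ler_pdivlMr; [nra | lra].
Qed.

(** * Catalan numbers through w_n, and identity (i) *)

Lemma catalanE (n : nat) :
  catalan R n = 2 ^+ (2 * n) * central_ratio n / (n%:R + 1).
Proof.
rewrite /catalan /central_ratio -natr1.
have h2 : 2 ^+ (2 * n) != 0 :> R by rewrite expf_neq0 ?pnatr_eq0.
by field; rewrite h2 natSr_neq0.
Qed.

Lemma catalan_div_pow4 (n : nat) :
  catalan R n / 2 ^+ (2 * n) = central_ratio n / (n%:R + 1).
Proof.
rewrite catalanE.
have h2 : 2 ^+ (2 * n) != 0 :> R by rewrite expf_neq0 ?pnatr_eq0.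
by field; rewrite h2 natSr_neq0.
Qed.

(** Each summand w_k / (k + 1) equals 2 (w_k - w_(k+1)), and the right-hand side is 2 - 2
    w_(n+1). *)
Lemma sum_catalan_div_pow4 (n : nat) :
  \sum_(0 <= k < n.+1) catalan R k / 2 ^+ (2 * k)
  = 2 - (2 * n + 1)%:R / 2 ^+ (2 * n) * catalan R n.
Proof.
rewrite mulrAC -mulrA catalan_div_pow4 natrD natrM.
elim: n => [|n IH].
  by rewrite big_nat1 catalan_div_pow4 central_ratio0; field.
rewrite big_nat_recr //= IH catalan_div_pow4 central_ratioS -natr1.
have n0 : 0 <= n%:R :> R by [].
by field; rewrite natSr_neq0 andbT; apply/eqP; lra.
Qed.

(** * Alternating sums of 1 / w_k, and identity (ii) *)

(* Chu-Vandermonde for 2F1(-N, x + 1; x + 1/2; 1); the shift x makes the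
   induction on N go through by Pascal's rule. *)
Lemma alternating_sum_inv_central_ratio (N x : nat) :
  \sum_(k < N.+1) (-1) ^+ k * 'C(N, k)%:R / central_ratio (x + k)
  = (central_ratio x)^-1
    * \prod_(i < N) ((2 * i%:R - 1) / (2 * x%:R + 2 * i%:R + 1)).
Proof.
elim: N x => [|N IH] x.
  by rewrite big_ord1 big_ord0 addn0 expr0 bin0 !mulr1 mul1r.
have -> : \sum_(k < N.+2) (-1) ^+ k * 'C(N.+1, k)%:R / central_ratio (x + k)
    = \sum_(k < N.+1) (-1) ^+ k * 'C(N, k)%:R / central_ratio (x + k)
    - \sum_(k < N.+1) (-1) ^+ k * 'C(N, k)%:R / central_ratio (x.+1 + k).
  rewrite big_ord_recl [X in _ = X - _]big_ord_recl /= !bin0.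
  rewrite -addrA; congr (_ + _).
  under eq_bigr do rewrite /bump /= add1n binS natrD mulrDr mulrDl.
  rewrite big_split /= big_ord_recr /= bin_small // mulr0 mul0r addr0.
  congr (_ + _); rewrite -sumrN; apply: eq_bigr => k _.
  by rewrite exprS mulN1r !mulNr addnS addSn.
rewrite !IH big_ord_recr /=.
have d0 y : 2 * x%:R + 2 * y%:R + 1 != 0 :> R.
  by rewrite -mulrDr -natrD odd_natr_neq0.
(* Replacing x by x + 1 moves every denominator to the next index, so only the first and the last of
   them survive in the quotient of the two products. *)
have -> : \prod_(i < N) ((2 * i%:R - 1) / (2 * x.+1%:R + 2 * i%:R + 1))
  = \prod_(i < N) ((2 * i%:R - 1) / (2 * x%:R + 2 * i%:R + 1))
    * ((2 * x%:R + 1) / (2 * x%:R + 2 * N%:R + 1)) :> R.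
  elim: {IH} N => [|N IH].
    by rewrite !big_ord0 mul1r mulr0 addr0 divff ?odd_natr_neq0.
  rewrite !big_ord_recr /= IH -!natr1.
  have x0 : 0 <= x%:R :> R by [].
  have N0 : 0 <= N%:R :> R by [].
  by field; repeat (apply/andP; split); apply/eqP; lra.
rewrite central_ratioS.
field.
by rewrite d0 odd_natr_neq0 natSr_neq0 (gt_eqF (central_ratio_gt0 x)).
Qed.

(** Each numerator cancels the preceding denominator, leaving the first numerator -1 over the last
    denominator 2N - 1. *)
Lemma prod_odd_telescope (N : nat) :
  \prod_(i < N) ((2 * i%:R - 1) / (2 * i%:R + 1)) = (1 - 2 * N%:R)^-1 :> R.
Proof.
elim: N => [|N IH]; first by rewrite big_ord0 mulr0 subr0 invr1.
rewrite big_ord_recr /= IH -natr1.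
have h : 1 - 2 * N%:R != 0 :> R.
  rewrite subr_eq0 eq_sym -natrM -[1]/(1%:R) eqr_nat; apply/eqP; lia.
have h1 := odd_natr_neq0 N.
field; rewrite h h1 /= andbT.
by apply: contra h1 => /eqP h1; apply/eqP; lra.
Qed.

Lemma alternating_sum_inv_catalan (n : nat) :
  \sum_(1 <= k < n.+1)
    (-1) ^+ (n - k) * 'C(n + 1, k)%:R
      * (2 ^+ (2 * k) / ((k + 1)%:R * catalan R k))
  = 2 / (2 * n + 1)%:R
      * (2 ^+ (2 * n) / catalan R n - (-1) ^+ n * (n + 1)%:R).
Proof.
have c0 k : central_ratio k != 0 by rewrite gt_eqF ?central_ratio_gt0.
have invC k : 2 ^+ (2 * k) / catalan R k = (k%:R + 1) / central_ratio k.
  by rewrite -invf_div catalan_div_pow4 invf_div.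
(* At x = 0 the product becomes the telescoping one. *)
have H := alternating_sum_inv_central_ratio n.+1 0.
rewrite central_ratio0 invr1 mul1r mulr0 in H.
rewrite (eq_bigr (fun i : 'I_n.+1 => (2 * i%:R - 1) / (2 * i%:R + 1))) in H;
  last by move=> i _; rewrite add0r.
rewrite prod_odd_telescope big_ord_recr big_ord_recl /= in H.
rewrite bin0 binn central_ratio0 central_ratioS in H.
rewrite big_add1 /= big_mkord invC [(2 * n + 1)%:R]natrD natrM [(n + 1)%:R]natrD.
have -> : \sum_(i < n) (-1) ^+ (n - i.+1) * 'C(n + 1, i.+1)%:R *
    (2 ^+ (2 * i.+1) / ((i.+1 + 1)%:R * catalan R i.+1))
  = (-1) ^+ n * \sum_(i < n) (-1) ^+ (bump 0 i) * 'C(n.+1, bump 0 i)%:R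
      / central_ratio (0 + bump 0 i).
  rewrite mulr_sumr; apply: eq_bigr => i _.
  rewrite /bump /= add1n add0n addn1 invfM [2 ^+ _ * (_ * _)]mulrCA invC.
  rewrite [(i.+1 + 1)%:R]natrD.
  (* The subtraction is not truncated since i < n, so parities add. *)
  have -> : (-1) ^+ (n - i.+1) = (-1) ^+ n * (-1) ^+ i.+1 :> R.
    by rewrite -signr_odd oddB ?ltn_ord // signr_addb !signr_odd.
  have i0 : 0 <= i%:R :> R by [].
  by field; rewrite c0 /=; apply/eqP; lra.
set S := \sum_(i < n) _ in H *.
have n0 : 0 <= n%:R :> R by [].
have hs : (-1) ^+ n * (-1) ^+ n = 1 :> R by rewrite -expr2 sqrr_sign.
have -> : S = (1 - 2 * n.+1%:R)^-1 - 1 + (-1) ^+ n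
   / (central_ratio n * ((2 * n%:R + 1) / (2 * (n%:R + 1)))).
  by rewrite -H exprS expr0 !mulr1 divr1; ring.
rewrite mulrDr [_ * (_ / _)]mulrA hs -natr1.
have o0 := odd_natr_neq0 n.
field; rewrite c0 o0 natSr_neq0 /=.
by apply/eqP; lra.
Qed.

(** * Shifted odd products, and the partial sums of (iii) *)

(** The difference is taken in [R], because the factors with j > k are negative. *)
Definition odd_shift_prod (m k : nat) : R :=
  \prod_(1 <= j < m.+1) (2 * (k%:R - j%:R) + 1).

Lemma odd_shift_prodSr (m k : nat) :
  odd_shift_prod m.+1 k = odd_shift_prod m k * (2 * (k%:R - m.+1%:R) + 1).
Proof. by rewrite /odd_shift_prod big_nat_recr. Qed.

Lemma odd_shift_prod0 (k : nat) : odd_shift_prod 0 k = 1.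
Proof. by rewrite /odd_shift_prod big_geq. Qed.

Lemma odd_shift_norm_ge1 (k j : nat) : 1 <= `|2 * (k%:R - j%:R) + 1| :> R.
Proof.
case: (leqP j k) => h.
  have h1 : j%:R <= k%:R :> R by rewrite ler_nat.
  by rewrite ler_normr; apply/orP; left; lra.
have h1 : k%:R + 1 <= j%:R :> R by rewrite natr1 ler_nat.
by rewrite ler_normr; apply/orP; right; lra.
Qed.

(** A product of odd integers; the bound gives nonvanishing here and later lets w_n dominate the
    remainder of the series. *)
Lemma odd_shift_prod_norm_ge1 (m k : nat) : 1 <= `|odd_shift_prod m k|.
Proof.
elim: m => [|m IH]; first by rewrite odd_shift_prod0 normr1.
by rewrite odd_shift_prodSr normrM mulr_ege1 ?odd_shift_norm_ge1.
Qed.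

Lemma odd_shift_prod_neq0 (m k : nat) : odd_shift_prod m k != 0.
Proof.
by rewrite -normr_gt0 (lt_le_trans ltr01) ?odd_shift_prod_norm_ge1.
Qed.

(** Both sides are the product of 2 (k - j) + 1 over 0 <= j <= m. *)
Lemma odd_shift_prodS (m k : nat) :
  odd_shift_prod m k.+1 * (2 * (k%:R - m%:R) + 1)
  = odd_shift_prod m k * (2 * k%:R + 1).
Proof.
elim: m => [|m IH]; first by rewrite !odd_shift_prod0 subr0.
rewrite !odd_shift_prodSr.
have -> : 2 * (k.+1%:R - m.+1%:R) + 1 = 2 * (k%:R - m%:R) + 1 :> R.
  by rewrite -!natr1; ring.
by rewrite IH; ring.
Qed.

(* The summand t_k satisfies (k + 2) t_{k+1} = (k - m + 1/2) t_k, hence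
   (k + 2) t_{k+1} - (k + 1) t_k = - (m + 1/2) t_k telescopes. *)
Lemma sum_catalan_odd_shift (m n : nat) :
  \sum_(0 <= k < n) catalan R k / (2 ^+ (2 * k) * odd_shift_prod m k)
  = 2 / (2 * m%:R + 1)
    * ((odd_shift_prod m 0)^-1 - central_ratio n / odd_shift_prod m n).
Proof.
have m0 := odd_natr_neq0 m.
elim: n => [|n IH]; first by rewrite big_geq // central_ratio0 mul1r subrr mulr0.
rewrite big_nat_recr //= IH invfM mulrA catalan_div_pow4 central_ratioS.
have f0 := odd_shift_prod_neq0 m.
have e : (odd_shift_prod m n.+1)^-1
    = (2 * (n%:R - m%:R) + 1) / (odd_shift_prod m n * (2 * n%:R + 1)).
  apply: (mulfI (f0 n.+1)); rewrite mulfV // mulrA odd_shift_prodS mulfV //.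
  by rewrite mulf_neq0 ?odd_natr_neq0.
rewrite e.
by field; rewrite !f0 natSr_neq0 odd_natr_neq0 m0.
Qed.

(** Both sides equal 2 (-1)^m / (2m + 1)!!, since (m + 2)! C_(m+1) = 2^(m+1) (2m + 1)!!. In the
    induction each gains the factor -1 / (2m + 3). *)
Lemma inv_odd_shift_prod_catalan (m : nat) :
  2 / (2 * m%:R + 1) / odd_shift_prod m 0
  = (-1) ^+ m * 2 ^+ (m + 2) / (((m + 2)`!)%:R * catalan R (m + 1)).
Proof.
have c0 k : central_ratio k != 0 by rewrite gt_eqF ?central_ratio_gt0.
have p0 k : 2 ^+ k != 0 :> R by rewrite expf_neq0 ?pnatr_eq0.
have k0 k : k`!%:R != 0 :> R by rewrite pnatr_eq0 -lt0n fact_gt0.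
rewrite !addnS !addn0 catalanE.
elim: m => [|m IH].
  rewrite odd_shift_prod0 central_ratioS central_ratio0 !factS fact0.
  by field.
have f0 := odd_shift_prod_neq0 m 0.
have m0 : 0 <= m%:R :> R by [].
have -> : 2 / (2 * m.+1%:R + 1) / odd_shift_prod m.+1 0
  = 2 / (2 * m%:R + 1) / odd_shift_prod m 0 * (- (2 * m.+1%:R + 1)^-1).
  rewrite odd_shift_prodSr; field; rewrite f0 /=.
  by repeat (apply/andP; split); apply/eqP; lra.
rewrite IH (central_ratioS m.+1) [_.+3`!]factS natrM.
rewrite [2 ^+ m.+3]exprS [(-1) ^+ m.+1]exprS.
rewrite (_ : 2 * m.+2 = (2 * m.+1).+2)%N ?[2 ^+ (2 * m.+1).+2]exprS; last by lia.
rewrite [2 ^+ (2 * m.+1).+1]exprS.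
field; rewrite c0 p0 k0 /= andbT.
by repeat (apply/andP; split); apply/eqP; lra.
Qed.

End Sums.

(** * Limits, and the four identities together *)

Lemma cvg_central_ratio (R : realType) : central_ratio R @ \oo --> (0 : R).
Proof.
have h : (fun n => Num.sqrt (harmonic n)) @ \oo --> (0 : R).
  rewrite -[X in _ --> X]sqrtr0; apply: continuous_cvg; last exact: cvg_harmonic.
  exact: sqrt_continuous.
apply: (squeeze_cvgr _ (cvg_cst 0) h).
apply: nearW => n; rewrite ltW ?central_ratio_gt0 //=.
rewrite -(ger0_norm (ltW (central_ratio_gt0 R n))) -sqrtr_sqr ler_wsqrtr //.
(* The bound 1 / (2n + 1) is weakened to the harmonic term 1 / (n + 1). *)
rewrite (le_trans (central_ratio_sqr_le R n)) // lef_pV2 ?posrE -natr1.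
- have : 0 <= n%:R :> R by []; lra.
- by rewrite ltr_wpDl // mulr_ge0.
- by rewrite ltr_wpDl.
Qed.

Theorem corollary1 (R : realType) (n m : nat) :
  [/\ \sum_(0 <= k < n.+1) catalan R k / 2 ^+ (2 * k)
        = 2 - (2 * n + 1)%:R / 2 ^+ (2 * n) * catalan R n,
      \sum_(1 <= k < n.+1)
          (-1) ^+ (n - k) * 'C(n + 1, k)%:R
            * (2 ^+ (2 * k) / ((k + 1)%:R * catalan R k))
        = 2 / (2 * n + 1)%:R
            * (2 ^+ (2 * n) / catalan R n - (-1) ^+ n * (n + 1)%:R),
      series (fun k : nat => catalan R k /
          (2 ^+ (2 * k) * \prod_(1 <= j < m.+1) (2 * (k%:R - j%:R) + 1)))
        @ \oo --> (-1) ^+ m * 2 ^+ (m + 2) / (((m + 2)`!)%:R * catalan R (m + 1))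
    & series (fun k : nat => catalan R k / 2 ^+ (2 * k)) @ \oo --> (2 : R)].
Proof.
(* Stated for every j, to serve at j = m for (iii) and at j = 0 for (iv). *)
have cvgS (j : nat) : series (fun k : nat => catalan R k /
    (2 ^+ (2 * k) * odd_shift_prod R j k)) @ \oo -->
    (-1) ^+ j * 2 ^+ (j + 2) / (((j + 2)`!)%:R * catalan R (j + 1)).
  rewrite -inv_odd_shift_prod_catalan.
  (* The added 0 is the limit of the remainder in the closed form of the partial sums. *)
  rewrite -[(odd_shift_prod R j 0)^-1]subr0.
  rewrite [series _](funext (sum_catalan_odd_shift R j)).
  apply: cvgMr; apply: cvgB; first exact: cvg_cst.
  apply/norm_cvg0P.
  apply: (squeeze_cvgr _ (cvg_cst 0) (cvg_central_ratio R)).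
  apply: nearW => k; rewrite normr_ge0 normrM normfV.
  rewrite (ger0_norm (ltW (central_ratio_gt0 R k))) /=.
  rewrite ler_piMr ?(ltW (central_ratio_gt0 R k)) //.
  by rewrite invf_le1 ?odd_shift_prod_norm_ge1 // normr_gt0 odd_shift_prod_neq0.
split.
- exact: sum_catalan_div_pow4.
- exact: alternating_sum_inv_catalan.
- exact: cvgS.
- have := cvgS 0%N; rewrite -inv_odd_shift_prod_catalan.
  rewrite odd_shift_prod0 mulr0 add0r !divr1.
  by under eq_fun do rewrite odd_shift_prod0 mulr1.
Qed.
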